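(* Let $n,m,b\ge 1$ be integers and let $A$ be any $n\times m$ matrix with entries in $\mathbb{F}_2$. Then there exist an $n\times n$ permutation matrix $P$, an integer $r$ with $0\le r\le \min(n,m)$, a matrix $L\in\mathrm{Mat}(n,r,\mathbb{F}_2)$ and a matrix $U\in\mathrm{Mat}(r,m,\mathbb{F}_2)$ such that $$PA = LU,$$ where $U$ is a full rank (that is, $\operatorname{rank}(U)=r$) upper block triangular matrix with respect to column blocks of width $b$, and $L$ is a full rank (that is, $\operatorname{rank}(L)=r$) lower trapezoidal matrix.
   Context: $\mathrm{Mat}(p,q,\mathbb{F}_2)$ denotes the set of $p\times q$ matrices over the field $\mathbb{F}_2$ with two elements; matrices with zero rows or zero columns are allowed (they have rank $0$, and the product of an $n\times 0$ matrix and a $0\times m$ matrix is the $n\times m$ zero matrix). The integer $b$ is the block width (in applications, the number of bits in a machine word). Let $\mu=\lceil m/b\rceil$. The $m$ columns are divided into $\mu$ consecutive blocks, indexed $0,1,\dots,\mu-1$: blocks $0,\dots,\mu-2$ have width $b_j=b$, and the last block has width $b_{\mu-1}=m-(\mu-1)b\le b$. An $r\times m$ matrix $U$ is upper block triangular with respect to column blocks of width $b$ (also called upper block staircase) if there are integers $r_0,\dots,r_{\mu-1}$ with $0\le r_j\le b_j$ and $r_0+\cdots+r_{\mu-1}=r$ such that, when the rows of $U$ are divided into consecutive blocks of sizes $r_0,\dots,r_{\mu-1}$ and its columns into the consecutive blocks of widths $b_0,\dots,b_{\mu-1}$, the $(i,j)$ block of $U$ (which has size $r_i\times b_j$) is zero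 whenever $j<i$. An $n\times r$ matrix $L$ with $n\ge r$ is lower trapezoidal if its $(i,j)$ entry is zero whenever $i<j$. *)

(* Defs.v *)
From mathcomp Require Import all_boot all_order all_algebra.

Set Implicit Arguments.
Unset Strict Implicit.
Unset Printing Implicit Defensive.

Import GRing.Theory.

(* ceil (m / b), for b > 0 *)
Definition num_blocks (m b : nat) : nat := (m + b.-1) %/ b.

Definition block_width (m b j : nat) : nat :=
  if j.+1 < num_blocks m b then b else m - (num_blocks m b).-1 * b.

(* The index k lies in block j when consecutive blocks have sizes w 0, w 1, ... *)
Definition in_block (w : nat -> nat) (j k : nat) : bool :=
  \sum_(i < j) w i <= k < \sum_(i < j.+1) w i.

(* The block sizes rho j only matter for j < num_blocks m b; a block size may
   be 0, in which case no index lies in that block. *)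
Definition upper_block_triangular (R : nmodType) (b r m : nat)
    (U : 'M[R]_(r, m)) : Prop :=
  exists rho : nat -> nat,
    [/\ forall j, j < num_blocks m b -> rho j <= block_width m b j,
        \sum_(j < num_blocks m b) rho j = r
      & forall i j, i < num_blocks m b -> j < i ->
          forall (a : 'I_r) (c : 'I_m),
            in_block rho i a -> in_block (block_width m b) j c ->
            U a c = 0%R].

Definition lower_trapezoidal (R : nmodType) (n r : nat)
    (L : 'M[R]_(n, r)) : Prop :=
  r <= n /\ forall (i : 'I_n) (j : 'I_r), i < j -> L i j = 0%R.

(* Main.v *)
Require Import Defs.
From mathcomp Require Import all_boot all_order all_algebra.
From mathcomp Require Import perm.

(** Gaussian elimination with row exchanges, column by column, brings [A] to
    row echelon form whatever the field, which gives [P *m A = L *m U] with [L]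
    lower trapezoidal, [U] in echelon form and both of full rank
    ([trapezoidal_staircase_factorization]).  An echelon matrix is then upper
    block triangular for every way of cutting its columns into consecutive
    blocks: let the [j]-th block of rows consist of the rows whose pivot lies in
    the [j]-th block of columns.  There are at most as many pivots as columns in
    a block, and a row vanishes to the left of its pivot, hence on all the
    earlier column blocks ([staircase_upper_block_triangular]).

    The shape of [U] is recorded by the boolean predicate [p] of its pivot
    columns, rather than by the increasing list of pivot positions: row [a] has
    its pivot at or before column [c] exactly when more than [a] of the columns
    [0, ..., c] satisfy [p].  Sizes and positions of blocks thus become partial
    sums of [p], which telescope. *)

Set Implicit Arguments.
Unset Strict Implicit.
Unset Printing Implicit Defensive.

Import GRing.Theory.
Local Open Scope ring_scope.

Lemma sum_block_width (m b : nat) :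
  (0 < m)%N -> (0 < b)%N ->
  (\sum_(j < num_blocks m b) block_width m b j = m)%N.
Proof.
move=> m_gt0 b_gt0.
(* In this form of the ceiling every block but the last visibly fits in m. *)
have nbE : num_blocks m b = (m.-1 %/ b).+1.
  by rewrite /num_blocks -(prednK m_gt0) -(prednK b_gt0) addSnnS divnDr ?dvdnn //
             prednK // divnn b_gt0 addn1.
rewrite /block_width nbE big_ord_recr /= ltnn.
under eq_bigr => j _ do rewrite ltnS ltn_ord.
rewrite sum_nat_const card_ord subnKC //.
exact: leq_trans (leq_divM _ _) (leq_pred _).
Qed.

(** Echelon shape with pivot columns [p].  Nothing is said of the pivots
    themselves, so [U] may have a smaller rank than [r]; full rank is
    established separately. *)
Definition staircase (R : nmodType) (r m : nat) (p : nat -> bool)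
    (U : 'M[R]_(r, m)) : Prop :=
  (\sum_(k < m) p k = r)%N /\
  forall (a : 'I_r) (c : 'I_m), (\sum_(k < c.+1) p k <= a)%N -> U a c = 0.

(** Row block [j] collects the rows with a pivot in column block [j], so that
    the rows preceding row block [j] are as many as the pivots preceding column
    block [j]. *)
Lemma staircase_upper_block_triangular (R : nmodType) (b r m : nat)
    (p : nat -> bool) (U : 'M[R]_(r, m)) :
  (0 < m)%N -> (0 < b)%N -> staircase p U -> upper_block_triangular b U.
Proof.
move=> m_gt0 b_gt0 [sum_p U0].
pose S j := (\sum_(i < j) block_width m b i)%N.
have S_S j : S j.+1 = (S j + block_width m b j)%N by rewrite /S big_ord_recr.
have S_le i j : (i <= j)%N -> (S i <= S j)%N.
  apply: (homo_leq leqnn leq_trans) => k.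
  by rewrite S_S leq_addr.
pose rho j := (\sum_(S j <= k < S j.+1) p k)%N.
have sum_rho j : (\sum_(i < j) rho i = \sum_(0 <= k < S j) p k)%N.
  elim: j => [|j IHj]; first by rewrite /S !big_ord0 big_geq.
  by rewrite big_ord_recr IHj -big_cat_nat // S_le.
exists rho; split=> [j _||i j _ lt_ji a c].
- rewrite /rho (leq_trans (n := \sum_(S j <= k < S j.+1) 1)%N) //.
    by apply: leq_sum => k _; exact: leq_b1.
  by rewrite sum_nat_const_nat muln1 S_S addKn.
- by rewrite sum_rho /S sum_block_width // big_mkord.
rewrite /in_block sum_rho => /andP[le_a _] /andP[_ lt_c]; apply: U0.
apply: leq_trans le_a; rewrite -(big_mkord xpredT (fun k => nat_of_bool (p k))).
have le_cS : (c.+1 <= S i)%N by apply: leq_trans lt_c (S_le _ _ lt_ji).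
by rewrite [leqRHS](big_cat_nat (leq0n _) le_cS) //= leq_addr.
Qed.

Definition pred_cons (first : bool) (p : nat -> bool) (k : nat) : bool :=
  if k is k'.+1 then p k' else first.

Lemma sum_pred_cons first p n :
  (\sum_(k < n.+1) pred_cons first p k = first + \sum_(k < n) p k)%N.
Proof. by rewrite big_ord_recl. Qed.

(** A column without pivot is prepended: elimination meets a zero column. *)
Lemma staircase_row0 (R : pzSemiRingType) (r m : nat) p (U : 'M[R]_(r, m)) :
  staircase p U ->
  staircase (pred_cons false p) (row_mx (0 : 'M_(r, 1)) U).
Proof.
move=> [sum_p U0]; split=> [|a c]; first by rewrite sum_pred_cons.
rewrite mxE; case: splitP => [j _|j cE]; first by rewrite mxE.
by rewrite sum_pred_cons cE => /U0.
Qed.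

(** A pivot row and its column are prepended: one step of elimination.  Both
    sides of the defining inequality grow by one for the rows of [U]. *)
Lemma staircase_block (R : pzSemiRingType) (r m : nat) p (d : 'M[R]_1) (v : 'rV_m)
    (U : 'M[R]_(r, m)) :
  staircase p U -> staircase (pred_cons true p) (block_mx d v 0 U).
Proof.
move=> [sum_p U0]; split=> [|a c]; first by rewrite sum_pred_cons sum_p.
rewrite sum_pred_cons mxE; case: splitP => i aE; first by rewrite aE ord1.
by rewrite mxE; case: splitP => j cE; rewrite ?mxE // aE cE => /U0.
Qed.

Lemma lower_trapezoidal_block (R : pzSemiRingType) (n r : nat) (d : 'M[R]_1)
    (w : 'cV_n) (L : 'M[R]_(n, r)) :
  lower_trapezoidal L -> lower_trapezoidal (block_mx d 0 w L).
Proof.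
move=> [le_rn L0]; split=> // a c.
rewrite mxE; case: splitP => i ->; rewrite mxE; case: splitP => j ->.
- by rewrite !ord1.
- by rewrite mxE.
- by rewrite ord1.
- exact: L0.
Qed.

Lemma row_free_ublock (F : fieldType) (n1 n2 m1 m2 : nat) (d : 'M[F]_(n1, m1)) v
    (U : 'M[F]_(n2, m2)) :
  row_free d -> row_free U -> row_free (block_mx d v 0 U).
Proof.
move=> /row_freeP[d' dK] /row_freeP[U' UK]; apply/row_freeP.
exists (block_mx d' (- (d' *m v *m U')) 0 U').
rewrite mulmx_block !mul0mx !mulmx0 !addr0 add0r dK UK mulmxN !mulmxA dK mul1mx.
by rewrite addNr -scalar_mx_block.
Qed.

Lemma row_full_lblock (F : fieldType) (n1 n2 m1 m2 : nat) (d : 'M[F]_(n1, m1)) w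
    (L : 'M[F]_(n2, m2)) :
  row_full d -> row_full L -> row_full (block_mx d 0 w L).
Proof.
move=> /row_fullP[d' dK] /row_fullP[L' LK]; apply/row_fullP.
exists (block_mx d' 0 (- (L' *m w *m d')) L').
rewrite mulmx_block !mul0mx !mulmx0 !addr0 add0r dK LK mulNmx -[_ *m d]mulmxA dK.
by rewrite mulmx1 addNr -scalar_mx_block.
Qed.

(** Induction on the number of columns.  If the first column is zero, the
    factorization of the other columns is extended by a zero column of [U].
    Otherwise a row exchange puts a nonzero [d] in the top left corner, and the
    factorization of the Schur complement [C - d^-1 *: w *m v] is bordered by
    the pivot row [(d, v)] in [U] and by the column of multipliers [d^-1 *: w],
    permuted by [P], in [L]. *)
Lemma trapezoidal_staircase_factorization (F : fieldType) (n m : nat)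
    (A : 'M[F]_(n, m)) :
  exists (P : 'M[F]_n) (r : nat) (p : nat -> bool)
         (L : 'M[F]_(n, r)) (U : 'M[F]_(r, m)),
    [/\ is_perm_mx P, P *m A = L *m U, row_free U /\ staircase p U
      & row_full L /\ lower_trapezoidal L].
Proof.
elim: m n A => [|m IHm] n A.
  exists 1%:M, 0%N, xpred0, 0, 0; split; rewrite ?is_perm_mx1 ?mulmx0 //.
  - by rewrite [1%:M *m A]thinmx0.
  - by split; [rewrite /row_free mxrank0 | split=> [|[]//]; rewrite big_ord0].
  - by split; [rewrite /row_full mxrank0 | split=> // i []].
rewrite -[m.+1]/(1 + m)%N in A *.
have [A0 | [i0 nz_i0]] : lsubmx A = 0 \/ exists i0, A i0 0 != 0.
  case: (pickP (fun i => A i 0 != 0)) => [i0 nz|z]; [by right; exists i0 | left].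
  apply/matrixP => i j; rewrite !mxE ord1; apply/eqP.
  by rewrite -[_ == _]negbK; apply/negbT; rewrite -(z i); congr (A _ _ != _); exact: val_inj.
- have [P [r [p [L [U [permP PA [freeU stairU] LP]]]]]] := IHm n (rsubmx A).
  exists P, r, (pred_cons false p), L, (row_mx 0 U); split=> //.
    by rewrite -[A]hsubmxK A0 !mul_mx_row !mulmx0 PA.
  split; last exact: staircase_row0.
  by rewrite /row_free rank_row_0mx.
case: n A i0 nz_i0 => [A []//|n A i0 nz_i0].
rewrite -[n.+1]/(1 + n)%N in A i0 nz_i0 *.
pose B : 'M_(1 + n, 1 + m) := tperm_mx i0 0 *m A.
pose d := B 0 0.
have nz_d : d != 0 by rewrite /d /B -xrowE !mxE tpermR.
have BE : B = block_mx d%:M (ursubmx B) (dlsubmx B) (drsubmx B).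
  rewrite -[LHS]submxK [ulsubmx B]mx11_scalar; congr (block_mx _%:M _ _ _).
  by rewrite 2!mxE; congr (B _ _); exact: val_inj.
set v := ursubmx B in BE; set w := dlsubmx B in BE; set C := drsubmx B in BE.
have [P [r [p [L [U [permP PS [freeU stairU] [fullL trapL]]]]]]] :=
  IHm n (C - d^-1 *: w *m v).
exists (lift0_mx P *m tperm_mx i0 0), (1 + r)%N, (pred_cons true p).
exists (block_mx 1%:M 0 (d^-1 *: (P *m w)) L), (block_mx d%:M v 0 U).
split.
- have /is_perm_mxP[s ->] := permP.
  by rewrite is_perm_mxMl ?lift0_mx_is_perm //; exact: perm_mx_is_perm.
- rewrite -mulmxA -/B BE !mulmx_block !mul0mx !mulmx0 !mul1mx !addr0 ?add0r -PS.
  rewrite mulmxBr scalemxAr mulmxA addrC subrK mul_mx_scalar -scalemxAr scalerA.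
  by rewrite mulfV // scale1r.
- split; last exact: staircase_block.
  by apply: row_free_ublock; rewrite // row_free_unit unitmxE det_scalar1 unitfE.
- split; last exact: lower_trapezoidal_block.
  by apply: row_full_lblock; rewrite // row_full_unit unitmx1.
Qed.

Theorem lemma4p1 (n m b : nat) (hn : (1 <= n)%N) (hm : (1 <= m)%N)
    (hb : (1 <= b)%N) (A : 'M['F_2]_(n, m)) :
  exists (P : 'M['F_2]_n) (r : nat) (L : 'M['F_2]_(n, r)) (U : 'M['F_2]_(r, m)),
    is_perm_mx P /\ (r <= minn n m)%N /\
    P *m A = L *m U /\
    (\rank U = r /\ upper_block_triangular b U) /\
    (\rank L = r /\ lower_trapezoidal L).
Proof.
have [P [r [p [L [U [permP PA [/eqP rankU stairU] [/eqP rankL trapL]]]]]]] :=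
  trapezoidal_staircase_factorization A.
exists P, r, L, U; do 4?split=> //.
- by rewrite leq_min -{1}rankL -{2}rankU rank_leq_row rank_leq_col.
- by split=> //; exact: staircase_upper_block_triangular stairU.
Qed.
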